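(* Let $N\ge3$ and consider the relative equilibrium $e^{\mathbb{J}\omega_1t}C$, $C=(1,\zeta,\dots,\zeta^{N-1})$, $\zeta=e^{2\pi i/N}$, of $N$ unit masses in $\mathbb{R}^3$. After reduction by translations and rotations, the restriction of the quadratic part of the energy at the corresponding equilibrium to $$\mathcal{F}=\mathcal{H}_1\oplus\bigoplus_{1\le\ell\le N/2}\mathcal{V}_\ell$$ is positive definite.
   Context: Positions are in $\mathbb{R}^3=\mathbb{C}\times\mathbb{R}$ (horizontal $\times$ vertical), $\mathbb{J}$ is multiplication by $i$ on horizontal components and $0$ on vertical ones, gravitational constant $1$. Bodies are labelled $0,\dots,N-1$. For $\rho_j=|\zeta^j-1|$, $\omega_\ell=\left(\sum_{j=1}^{N-1}\frac{1-\zeta^{j\ell}}{\rho_j^3}\right)^{1/2}$ are the vertical frequencies; $\omega_1$ is the frequency of the relative equilibrium. Energy: $H(x,\dot x)=\frac12\sum_j\|\dot x_j\|^2-\sum_{j<k}\frac1{\|x_j-x_k\|}$ on the phase space of states $(x,\dot x)$ with center of mass and linear momentum zero. Reduced space: fix the angular momentum $\sum_jx_j\wedge\dot x_j$ at its (vertical) value at $(C,\omega_1\mathbb{J}C)$ and quotient by rotations around the vertical axis; near the relative equilibrium it is a $(6N-10)$-dimensional symplectic manifold, on which $H$ induces the reduced Hamiltonian, and the relative equilibrium is a critical point $E$ of it. ''Quadratic part of the energy'' means the Hessian quadratic form of the reduced Hamiltonian at $E$. The tangent space at $E$ is the set of variations $(\delta x,\delta\dot x)$ of $(C,\omega_1\mathbb{J}C)$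 with vanishing first variation of angular momentum, modulo the infinitesimal rotation around the vertical axis. In it: - $\mathcal{H}_1$ is the plane tangent to homographic motions: the image of the variations $(\delta x,\delta\dot x)=(aC,bC)$, $a,b\in\mathbb{C}$ (horizontal), with vanishing first variation of angular momentum. - $\mathcal{V}_\ell$ is the vertical eigenspace of the frequency $\omega_\ell$: the image of the variations for which $\delta x_j=(0,z_j)$, $\delta\dot x_j=(0,w_j)$ with $z,w\in\mathbb{R}^N$ both in the real span of $(\cos\frac{2\pi j\ell}N)_{0\le j\le N-1}$ and $(\sin\frac{2\pi j\ell}N)_{0\le j\le N-1}$, and with vanishing first variation of angular momentum (this last condition is automatic if $\ell\ge2$; $\mathcal{V}_1$ has dimension $2$). *)

(* Defs.v *)
(* MathComp-Analysis, over an arbitrary [R : realType]. *)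
From HB Require Import structures.
From mathcomp Require Import all_boot all_order all_algebra.
From mathcomp Require Import all_classical all_reals all_analysis.
Import Order.TTheory GRing.Theory Num.Theory.
Import numFieldNormedType.Exports.

Set Implicit Arguments.
Unset Strict Implicit.
Unset Printing Implicit Defensive.

Local Open Scope ring_scope.
Local Open Scope classical_set_scope.

(* Row j of a configuration is the vector of R^3 = C x R attached to body j:
   columns 0 and 1 are the real and imaginary parts of the horizontal
   component, column 2 is the vertical component. *)
Notation config R N := 'M[R]_(N, 3).

(* A pair (x, xdot). As the ambient space is linear, the same type serves for
   the variations (delta x, delta xdot). *)
Notation state R N := ('M[R]_(N, 3) * 'M[R]_(N, 3))%type.

(* Argument of zeta ^ j, zeta = e^(2 i pi / N). *)
Definition angle (R : realType) (N j : nat) : R := 2 * pi * j%:R / N%:R.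

Definition polygon (R : realType) (N : nat) : config R N :=
  \matrix_(j, k) [:: cos (angle R N j); sin (angle R N j); 0]`_k.

Definition mulJ (R : realType) (N : nat) (X : config R N) : config R N :=
  \matrix_(j, k) [:: - X j 1; X j 0; 0]`_k.

(* |zeta ^ j - 1| *)
Definition rho (R : realType) (N j : nat) : R :=
  Num.sqrt ((cos (angle R N j) - 1) ^+ 2 + sin (angle R N j) ^+ 2).

(* Only the real part of 1 - zeta ^ (j l) is kept: the imaginary parts of the
   terms j and N - j cancel, so the complex sum is real. *)
Definition omega (R : realType) (N l : nat) : R :=
  Num.sqrt (\sum_(1 <= j < N) (1 - cos (angle R N (j * l))) / rho R N j ^+ 3).

Definition releq (R : realType) (N : nat) : state R N :=
  (polygon R N, omega R N 1 *: mulJ (polygon R N)).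

(* Euclidean norm ([`|u|] on row vectors is the sup norm). *)
Definition enorm (R : realType) (u : 'rV[R]_3) : R :=
  Num.sqrt (\sum_k u 0 k ^+ 2).

Definition energy (R : realType) (N : nat) (p : state R N) : R :=
  2^-1 * \sum_j enorm (row j p.2) ^+ 2
  - \sum_(j < N) \sum_(k < N | (j < k)%N) (enorm (row j p.1 - row k p.1))^-1.

(* sum_j x_j /\ y_j, a bivector being the antisymmetric matrix whose (a, b)
   entry is here sum_j (x_ja y_jb - x_jb y_ja). *)
Definition wedge (R : realType) (N : nat) (X Y : config R N) : 'M[R]_3 :=
  X^T *m Y - Y^T *m X.

Definition ang_mom (R : realType) (N : nat) (p : state R N) : 'M[R]_3 :=
  wedge p.1 p.2.

(* First variation of [ang_mom] at [releq]. *)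
Definition ang_mom_var (R : realType) (N : nat) (v : state R N) : 'M[R]_3 :=
  wedge v.1 (releq R N).2 + wedge (releq R N).1 v.2.

Definition centered (R : realType) (N : nat) (p : state R N) : Prop :=
  \sum_j row j p.1 = 0 /\ \sum_j row j p.2 = 0.

Definition phase_space (R : realType) (N : nat) (p : state R N) : Prop :=
  centered p /\ forall j k : 'I_N, j != k -> row j p.1 <> row k p.1.

(* The reduced space is the quotient of this set by the rotations around the
   vertical axis. *)
Definition momentum_level (R : realType) (N : nat) (p : state R N) : Prop :=
  phase_space p /\ ang_mom p = ang_mom (releq R N).

(* The tangent space of the reduced space at the relative equilibrium is
   [tangent] modulo the line [rot_line]; a vector of it is handled through its
   representatives in [tangent]. *)
Definition tangent (R : realType) (N : nat) (v : state R N) : Prop :=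
  centered v /\ ang_mom_var v = 0.

Definition rot_line (R : realType) (N : nat) (v : state R N) : Prop :=
  exists c : R, v = c *: (mulJ (releq R N).1, mulJ (releq R N).2).

Definition twice_derivable (R : realType) (f : R -> R) : Prop :=
  (\forall s \near (0 : R), derivable f s 1) /\ derivable f^`() 0 1.

(* Velocity at time 0, entry by entry. *)
Definition velocity0 (R : realType) (N : nat) (g : R -> state R N) : state R N :=
  (\matrix_(j, k) (fun s => (g s).1 j k)^`() 0,
   \matrix_(j, k) (fun s => (g s).2 j k)^`() 0).

(* Lift to the momentum level of a curve of the reduced space which passes
   through the equilibrium with velocity the class of v. *)
Definition reduced_curve (R : realType) (N : nat) (v : state R N)
    (g : R -> state R N) : Prop :=
  [/\ forall j k, twice_derivable (fun s => (g s).1 j k),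
      forall j k, twice_derivable (fun s => (g s).2 j k),
      \forall s \near (0 : R), momentum_level (g s),
      g 0 = releq R N
    & rot_line (velocity0 g - v)].

(* Q is the Hessian quadratic form of the reduced energy at the equilibrium:
   its value at the class of v is the second derivative of the energy along any
   curve of the reduced space with this velocity. Such curves exist for every
   tangent v, so Q is unique on [tangent]; that the second derivative depends
   on the velocity only is the criticality of the equilibrium. *)
Definition is_reduced_hessian (R : realType) (N : nat)
    (Q : state R N -> R) : Prop :=
  forall v : state R N, tangent v ->
    (exists g, reduced_curve v g) /\
    (forall g, reduced_curve v g ->
       twice_derivable (fun s => energy (g s)) /\
       (fun s => energy (g s))^`(2) 0 = Q v).

(* a X for the complex number a = a1 + i a2 and a horizontal X *)
Definition cscale (R : realType) (N : nat) (a1 a2 : R) (X : config R N) :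
    config R N :=
  a1 *: X + a2 *: mulJ X.

(* [homographic] and [vertical l] consist of representatives of the vectors of
   H_1 and V_l. *)
Definition homographic (R : realType) (N : nat) (v : state R N) : Prop :=
  tangent v /\ exists a1 a2 b1 b2 : R,
    v = (cscale a1 a2 (polygon R N), cscale b1 b2 (polygon R N)).

Definition vertical_mode (R : realType) (N l : nat) (a b : R) : config R N :=
  \matrix_(j, k)
    [:: 0; 0; a * cos (angle R N (j * l)) + b * sin (angle R N (j * l))]`_k.

Definition vertical (R : realType) (N l : nat) (v : state R N) : Prop :=
  tangent v /\ exists a b a' b' : R,
    v = (vertical_mode N l a b, vertical_mode N l a' b').

(* [h] and [u l], 1 <= l <= N / 2, are components in H_1 and the V_l. *)
Definition components (R : realType) (N : nat) (h : state R N)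
    (u : nat -> state R N) : Prop :=
  homographic h /\ forall l, (1 <= l <= N./2)%N -> vertical l (u l).

Definition csum (R : realType) (N : nat) (h : state R N)
    (u : nat -> state R N) : state R N :=
  h + \sum_(1 <= l < N./2.+1) u l.

(* Full preimage of F in [tangent]: [homographic] contains [rot_line]. *)
Definition in_F (R : realType) (N : nat) (v : state R N) : Prop :=
  exists h u, components h u /\ v = csum h u.

(* The sum of H_1 and the V_l is direct, modulo [rot_line]. *)
Definition F_is_direct (R : realType) (N : nat) : Prop :=
  forall (h : state R N) (u : nat -> state R N), components h u ->
    rot_line (csum h u) ->
    rot_line h /\ forall l, (1 <= l <= N./2)%N -> rot_line (u l).

Definition positive_definite_on (R : realType) (N : nat)
    (P : state R N -> Prop) (Q : state R N -> R) : Prop :=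
  forall v, P v -> ~ rot_line v -> 0 < Q v.

(* Main.v *)
Require Import Defs.
From mathcomp Require Import all_boot all_order all_algebra.
From mathcomp Require Import all_classical all_reals all_analysis.
From mathcomp Require Import ring lra.

(** The vertical component of the angular momentum, times the frequency w of the
    relative equilibrium, is a Lagrange multiplier term: since gravity at each
    vertex of the polygon is - w ^ 2 times its position ([polygon_central]), the
    relative equilibrium is critical for the augmented energy H - w G, where G is
    the vertical angular momentum. Along a curve on which G is constant, the second
    derivative of H is that of H - w G, and criticality makes it depend on the
    velocity only ([energy_jet2]). It is the quadratic form [hess]:

      |Y| ^ 2 - 2 w G(X, Y)
        + sum over pairs of (|D| ^ 2 / r ^ 3 - 3 (D . E) ^ 2 / r ^ 5),

    where (X, Y) is the velocity, r the mutual distance, and E, D the differences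
    of the two vertices and of the two rows of X. The form ignores
    infinitesimal rotations ([hess_rot]), hence is defined on the reduced tangent
    space. Every tangent vector is the velocity of a curve on the
    momentum level ([lifted_curve_reduced]), obtained by correcting the straight
    line through the equilibrium with a linear change of coordinates of space.

    Horizontal and vertical variations are orthogonal for the form
    ([hess_planar_upright]). On vertical ones it is

      |Y| ^ 2 + sum over pairs of (z_j - z_k) ^ 2 / r ^ 3,

    a sum of squares, whose only zeros are the vertical translations, which
    the fixed center of mass excludes. On the homographic variation (a C, b C),
    conservation of the angular momentum gives Im b = - w Re a, and the virial
    identity (the sum of the 1 / r over pairs is N w ^ 2) turns the form into

      N ((Re b + w Im a) ^ 2 + (w Re a) ^ 2),

    which vanishes on infinitesimal rotations only ([hess_homographic]).

    The sum of the modes is direct because they are eigenvectors of a symmetric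
    difference operator for the eigenvalues 2 cos (2 pi l / N), which are
    distinct for l between 1 and N / 2 ([modes_independent]). *)

Import Order.TTheory GRing.Theory Num.Theory.
Import numFieldNormedType.Exports.

Set Implicit Arguments.
Unset Strict Implicit.
Unset Printing Implicit Defensive.

Local Open Scope ring_scope.
Local Open Scope classical_set_scope.

(** * Second-order jets of real functions at 0 *)

(** Asking for a derivative [f'] as a witness, instead of using the total operator
    [derive1], makes the rules of calculus below direct consequences of those of
    [is_derive]. *)
Definition jet2 (R : realType) (f : R -> R) (a b c : R) : Prop :=
  exists f' : R -> R,
    [/\ \forall s \near (0 : R), is_derive (s : R) 1 f (f' s),
        is_derive (0 : R) 1 f' c, f 0 = a & f' 0 = b].

Section Jets.
Context {R : realType}.
Implicit Types (f g : R -> R) (a b c k : R).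

Lemma jet2_derive1 f a b c : jet2 f a b c -> f^`() 0 = b.
Proof.
move=> [f' [Hf _ _ <-]]; rewrite derive1E.
by have := nbhs_singleton Hf => /= H; exact: derive_val.
Qed.

Lemma jet2_near_derive1 f f' :
  (\forall s \near (0 : R), is_derive (s : R) 1 f (f' s)) ->
  \forall s \near (0 : R), f' s = f^`() s.
Proof. by apply: filterS => s H; rewrite derive1E; apply/esym/derive_val. Qed.

Lemma jet2_derive1n2 f a b c : jet2 f a b c -> f^`(2) 0 = c.
Proof.
move=> [f' [Hf Hf' _ _]]; rewrite derive1nS derive1n1 derive1E.
by have := near_eq_is_derive (jet2_near_derive1 Hf) Hf' => H;
  exact: derive_val.
Qed.

Lemma jet2_twice_derivable f a b c : jet2 f a b c -> twice_derivable f.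
Proof.
move=> [f' [Hf Hf' _ _]]; split; first by apply: filterS Hf => s [].
by case: (near_eq_is_derive (jet2_near_derive1 Hf) Hf').
Qed.

Lemma twice_derivable_jet2 f :
  twice_derivable f -> jet2 f (f 0) (f^`() 0)%classic (f^`(2) 0)%classic.
Proof.
move=> [H1 H2]; exists (f^`())%classic; split; [|  |by []|by []].
  by apply: filterS H1 => s /derivableP H; rewrite derive1E.
by rewrite derive1nS derive1n1 derive1E; exact/derivableP.
Qed.

Lemma jet2_near_eq f g a b c :
  (\forall s \near (0 : R), f s = g s) -> jet2 f a b c -> jet2 g a b c.
Proof.
move=> fg [f' [Hf Hf' Ha Hb]]; exists f'; split=> //; last first.
  by rewrite -(nbhs_singleton fg).
have := near_join fg; apply: filterS2 Hf => s fs fgs.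
by apply: (near_eq_is_derive _ fs).
Qed.

Lemma jet2_uniq2 f a b c a' b' c' :
  jet2 f a b c -> jet2 f a' b' c' -> c = c'.
Proof. by move=> /jet2_derive1n2 <- /jet2_derive1n2 <-. Qed.

Lemma jet2_eq f a b c a' b' c' :
  jet2 f a b c -> a = a' -> b = b' -> c = c' -> jet2 f a' b' c'.
Proof. by move=> ? <- <- <-. Qed.

Lemma jet2_continuous f a b c : jet2 f a b c -> {for 0, continuous f}.
Proof.
move=> [f' [/nbhs_singleton Hf _ _ _]].
by apply/differentiable_continuous/derivable1_diffP; case: Hf.
Qed.

Lemma jet2_cst k : @jet2 R (fun=> k) k 0 0.
Proof.
exists (fun=> 0); split=> //; last exact: is_derive_cst.
by apply: filterE => s; exact: is_derive_cst.
Qed.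

Lemma jet2_id : jet2 (id : R -> R) 0 1 0.
Proof.
exists (fun=> 1); split=> //; last exact: is_derive_cst.
by apply: filterE => s; exact: is_derive_id.
Qed.

Lemma jet2D f g a b c a' b' c' : jet2 f a b c -> jet2 g a' b' c' ->
  jet2 (fun s => f s + g s) (a + a') (b + b') (c + c').
Proof.
move=> [f' [Hf Hf' <- <-]] [g' [Hg Hg' <- <-]].
exists (fun s => f' s + g' s); split=> //; last exact: is_deriveD.
by apply: filterS2 Hf Hg => s fs gs; exact: is_deriveD.
Qed.

Lemma jet2M f g a b c a' b' c' : jet2 f a b c -> jet2 g a' b' c' ->
  jet2 (fun s => f s * g s) (a * a') (a * b' + b * a')
    (a * c' + 2 * b * b' + c * a').
Proof.
move=> [f' [Hf Hf' <- <-]] [g' [Hg Hg' <- <-]].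
exists (fun s => f s * g' s + f' s * g s); split=> //.
  apply: filterS2 Hf Hg => s fs gs.
  by apply: (is_derive_eq (is_deriveM fs gs)); rewrite /GRing.scale /=; ring.
have f0 := nbhs_singleton Hf; have g0 := nbhs_singleton Hg.
apply: (is_derive_eq (is_deriveD (is_deriveM f0 Hg') (is_deriveM Hf' g0))).
by rewrite /GRing.scale /=; ring.
Qed.

Lemma jet2_comp (phi phi' : R -> R) k f a b c :
    (\forall t \near a, is_derive (t : R) 1 phi (phi' t)) ->
    is_derive a 1 phi' k -> jet2 f a b c ->
  jet2 (phi \o f) (phi a) (phi' a * b) (k * b ^+ 2 + phi' a * c).
Proof.
move=> Hp Hp' jf; have cf := jet2_continuous jf.
move: jf Hp Hp' => [f' [Hf Hf' <- <-]] Hp Hp'.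
exists (fun s => phi' (f s) * f' s); split=> //.
  apply: filterS2 Hf (cf _ Hp) => s fs ps.
  exact: (is_derive_eq (is_derive1_comp ps fs)).
have f0 := nbhs_singleton Hf.
have p0 : is_derive (0 : R) 1 (phi' \o f) (k * f' 0) by exact: is_derive1_comp.
apply: (is_derive_eq (is_deriveM p0 Hf')).
by rewrite /GRing.scale /=; ring.
Qed.

Lemma jet2N f a b c : jet2 f a b c -> jet2 (fun s => - f s) (- a) (- b) (- c).
Proof.
move=> jf; apply: jet2_eq (_ : jet2 _ _ _ _) _ _ _.
- apply: (@jet2_near_eq (fun s => -1 * f s)); last first.
    exact: jet2M (jet2_cst (-1)) jf.
  by apply: filterE => s; rewrite mulN1r.
- by ring.
- by ring.
- by ring.
Qed.

Lemma jet2B f g a b c a' b' c' : jet2 f a b c -> jet2 g a' b' c' ->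
  jet2 (fun s => f s - g s) (a - a') (b - b') (c - c').
Proof. by move=> jf /jet2N; exact: jet2D. Qed.

Lemma jet2Z k f a b c : jet2 f a b c ->
  jet2 (fun s => k * f s) (k * a) (k * b) (k * c).
Proof.
by move=> /(jet2M (jet2_cst k)) jf; apply: (jet2_eq jf); ring.
Qed.

Lemma jet2X2 f a b c : jet2 f a b c ->
  jet2 (fun s => f s ^+ 2) (a ^+ 2) (2 * a * b) (2 * (b ^+ 2 + a * c)).
Proof.
by move=> jf; apply: (jet2_eq (jet2M jf jf)); ring.
Qed.

Lemma jet2_sum (I : Type) (r : seq I) (P : pred I) (F : I -> R -> R)
    (a b c : I -> R) :
  (forall i, P i -> jet2 (F i) (a i) (b i) (c i)) ->
  jet2 (fun s => \sum_(i <- r | P i) F i s) (\sum_(i <- r | P i) a i)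
    (\sum_(i <- r | P i) b i) (\sum_(i <- r | P i) c i).
Proof.
move=> H; elim: r => [|i r IH].
  rewrite !big_nil; apply: jet2_near_eq (jet2_cst 0).
  by apply: filterE => s; rewrite big_nil.
rewrite !big_cons; case: ifPn => Pi.
  apply: jet2_near_eq (jet2D (H i Pi) IH).
  by apply: filterE => s; rewrite big_cons Pi.
apply: jet2_near_eq IH.
by apply: filterE => s; rewrite big_cons (negbTE Pi).
Qed.

Lemma jet2V f a b c : a != 0 -> jet2 f a b c ->
  jet2 (fun s => (f s)^-1) a^-1 (- a^-1 ^+ 2 * b)
    (2 * a^-1 ^+ 3 * b ^+ 2 - a^-1 ^+ 2 * c).
Proof.
move=> a0 jf.
have dV (t : R) : t != 0 -> is_derive t 1 GRing.inv (- (t^-1 * t^-1)).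
  move=> t0; apply: (is_derive_eq (is_deriveV (f := id) t0 (is_derive_id _ _))).
  by rewrite /GRing.scale /= mulr1 expr2 invfM.
have dV2 : is_derive a 1 (fun t : R => - (t^-1 * t^-1)) (2 * a^-1 ^+ 3).
  apply: (is_derive_eq (is_deriveN (is_deriveM (dV _ a0) (dV _ a0)))).
  by rewrite /GRing.scale /=; ring.
apply: (jet2_eq (jet2_comp _ dV2 jf)) => //; last by ring.
near=> t; apply: dV; near: t.
exact: (cvgr_neq0 _ (@cvg_id _ (nbhs a)) a0).
Unshelve. all: by end_near. Qed.

(** With [f] a squared distance, this is the expansion of a Newtonian potential;
    the derivatives are written as powers of its value [i]. *)
Lemma jet2_inv_sqrt f a b c : 0 < a -> jet2 f a b c ->
  let i := (Num.sqrt a)^-1 in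
  jet2 (fun s => (Num.sqrt (f s))^-1) i (- 2^-1 * i ^+ 3 * b)
    (3 / 4 * i ^+ 5 * b ^+ 2 - 2^-1 * i ^+ 3 * c).
Proof.
move=> a0 jf i.
pose phi := (fun t : R => (Num.sqrt t)^-1).
have dphi (t : R) : 0 < t -> is_derive t 1 phi (- 2^-1 * (phi t * phi t * phi t)).
  move=> t0; have s0 : Num.sqrt t != 0 by rewrite gt_eqF// sqrtr_gt0.
  apply: (is_derive_eq (is_deriveV (f := Num.sqrt) s0 (is_derive1_sqrt t0))).
  by rewrite /GRing.scale /= /phi; field.
have dphi' : is_derive a 1 (fun t => - 2^-1 * (phi t * phi t * phi t))
    (3 / 4 * phi a ^+ 5).
  apply: (is_derive_eq (is_deriveM (is_derive_cst (- 2^-1 : R) a 1)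
    (is_deriveM (is_deriveM (dphi _ a0) (dphi _ a0)) (dphi _ a0)))).
  by rewrite /GRing.scale /= !fctE; field.
apply: (jet2_eq (jet2_comp (phi := phi) _ dphi' jf)) => //;
  [|by rewrite /i /phi; ring..].
near=> t; apply: dphi; near: t.
exact: (cvgr_gt _ (@cvg_id _ (nbhs a)) _ a0).
Unshelve. all: by end_near. Qed.

End Jets.

(** * The regular polygon as a central configuration *)

Lemma periodic_sum_shift (V : zmodType) (N : nat) (f : nat -> V) (m : nat) :
  (forall j, f (j + N)%N = f j) -> \sum_(j < N) f (j + m)%N = \sum_(j < N) f j.
Proof.
move=> fN; elim: m => [|m IH]; first by apply: eq_bigr => j _; rewrite addn0.
rewrite -IH; case: N fN {IH} => [|N] fN; first by rewrite !big_ord0.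
rewrite big_ord_recr [RHS]big_ord_recl /= addrC; congr (_ + _).
  by rewrite add0n -[RHS]fN; congr f; rewrite !addnS addnC.
by apply: eq_bigr => j _; rewrite addnS.
Qed.

Lemma sum_pairs (V : zmodType) (N : nat) (F : 'I_N -> 'I_N -> V) :
  \sum_j \sum_k F j k =
  \sum_(j < N) \sum_(k < N | (j < k)%N) (F j k + F k j) + \sum_j F j j.
Proof.
have -> : \sum_j \sum_k F j k = \sum_(j < N) \sum_(k < N | (j < k)%N) F j k +
    \sum_(j < N) \sum_(k < N | (k < j)%N) F j k + \sum_j F j j.
  rewrite -!big_split /=; apply: eq_bigr => j _.
  rewrite (bigID (fun k : 'I_N => (j < k)%N)) /= -addrA; congr (_ + _).
  rewrite (bigD1 j) ?ltnn //= addrC; congr (_ + _).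
  by apply: eq_bigl => k; rewrite -leqNgt ltn_neqAle andbC.
congr (_ + _); rewrite [X in _ + X](exchange_big_dep xpredT) //= -big_split /=.
by apply: eq_bigr => j _; rewrite big_split.
Qed.

(** Summation by parts over the edges of the complete graph. *)
Lemma sum_pairs_antisym (R : numDomainType) (N : nat)
    (g : 'I_N -> 'I_N -> R) (u : 'I_N -> R) :
  (forall j k, g j k = - g k j) ->
  \sum_(j < N) \sum_(k < N | (j < k)%N) g j k * (u j - u k) =
  \sum_j u j * \sum_k g j k.
Proof.
move=> gN; under [RHS]eq_bigr do rewrite big_distrr.
rewrite (sum_pairs (fun j k => u j * g j k)).
have gjj j : g j j = 0 by apply/eqP; rewrite -eqNr -gN.
rewrite [X in _ + X]big1 ?addr0; last by move=> j _; rewrite gjj mulr0.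
apply: eq_bigr => j _; apply: eq_bigr => k _; rewrite (gN k j); ring.
Qed.

Section Polygon.
Context {R : realType} {N : nat}.
Hypothesis N3 : (3 <= N)%N.

Let C := polygon R N.
Let w := omega R N 1.
Let c j := cos (angle R N j).
Let s j := sin (angle R N j).

Let N_gt0 : (0 < N)%N. Proof. exact: ltn_trans N3. Qed.
Let N_gt1 : (1 < N)%N. Proof. exact: ltn_trans N3. Qed.
Let N0 : N%:R != 0 :> R.
Proof. by rewrite pnatr_eq0 -lt0n. Qed.

Lemma angleD j k : angle R N (j + k) = angle R N j + angle R N k.
Proof. by rewrite /angle natrD mulrDr mulrDl. Qed.

Lemma angleDN j : angle R N (j + N) = angle R N j + pi *+ 2.
Proof. by rewrite angleD; congr (_ + _); rewrite /angle -mulr_natr; field. Qed.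

Lemma cos_angle_periodic j : cos (angle R N (j + N)) = cos (angle R N j).
Proof. by rewrite angleDN cosD2pi. Qed.

Lemma sin_angle_periodic j : sin (angle R N (j + N)) = sin (angle R N j).
Proof. by rewrite angleDN sinD2pi. Qed.

Lemma cos_angle_lt1 j : (0 < j < N)%N -> cos (angle R N j) < 1.
Proof.
move=> /andP[j0 jN].
have -> : angle R N j = (pi * j%:R / N%:R) *+ 2.
  by rewrite /angle -mulr_natr; field.
have Np : 0 < N%:R :> R by rewrite ltr0n.
(* cos x = 1 - 2 sin (x / 2) ^ 2, with x / 2 strictly between 0 and pi *)
have : 0 < sin (pi * j%:R / N%:R : R).
  apply: sin_gt0_pi; rewrite divr_gt0 ?mulr_gt0 ?pi_gt0 ?ltr0n//=.
  by rewrite ltr_pdivrMr// ltr_pM2l ?pi_gt0// ltr_nat.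
move=> /(exprn_gt0 2); rewrite sin2cos2 cos_mulr2n => ?; lra.
Qed.

Lemma rho_gt0 j : (0 < j < N)%N -> 0 < rho R N j.
Proof.
move=> /cos_angle_lt1 jN; rewrite sqrtr_gt0 ltr_pwDl ?sqr_ge0//.
by rewrite exprn_even_gt0//= subr_eq0 lt_eqF.
Qed.

Lemma omega1_sqr : w ^+ 2 = \sum_(m < N) (1 - c m) * (rho R N m)^-1 ^+ 3.
Proof.
rewrite /w /omega sqr_sqrtr; last first.
  rewrite sumr_ge0// => j _.
  by rewrite divr_ge0 ?exprn_ge0 ?sqrtr_ge0 ?subr_ge0 ?cos_le1.
have <- : \sum_(0 <= m < N) (1 - c m) * (rho R N m)^-1 ^+ 3 =
    \sum_(m < N) (1 - c m) * (rho R N m)^-1 ^+ 3 by rewrite big_mkord.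
rewrite [RHS]big_ltn // /c {2}/angle mulr0 mul0r cos0 subrr.
rewrite mul0r add0r; apply: eq_bigr => j _; rewrite muln1 exprVn //.
Qed.

Lemma omega1_gt0 : 0 < w.
Proof.
rewrite sqrtr_gt0 big_ltn // ltr_pwDl//.
  rewrite muln1 divr_gt0 ?subr_gt0 ?cos_angle_lt1 //.
  by rewrite exprn_gt0// rho_gt0 .
rewrite sumr_ge0// => j _; rewrite divr_ge0 ?exprn_ge0 ?sqrtr_ge0//.
Qed.

(** The bodies m and -m pull with opposite transverse components. *)
Lemma sum_sin_rho : \sum_(m < N) s m * (rho R N m)^-1 ^+ 3 = 0.
Proof.
set F := fun m => s m * (rho R N m)^-1 ^+ 3.
have FN m : (m <= N)%N -> F (N - m)%N = - F m.
  move=> mN; rewrite /F /s /rho.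
  have -> : angle R N (N - m) = - angle R N m + pi *+ 2.
    by rewrite /angle natrB// -mulr_natr; field.
  by rewrite sinD2pi cosD2pi sinN cosN sqrrN mulNr.
apply/eqP; rewrite -eqNr -sumrN; apply/eqP.
have sumE (G : nat -> R) : \sum_(m < N) G m = \sum_(0 <= m < N) G m.
  by rewrite big_mkord.
rewrite (sumE F) (sumE (fun m => - F m)).
rewrite big_ltn // [RHS]big_ltn //.
rewrite -FN// subn0; congr (_ + _).
  by rewrite /F /s /rho -(sin_angle_periodic 0) -(cos_angle_periodic 0) add0n.
rewrite [RHS]big_nat_rev /= big_nat [RHS]big_nat; apply: eq_bigr => m /andP[_ mN].
by rewrite -FN ?(ltnW mN)// addSn subSS.
Qed.

Let chord j k := Num.sqrt ((c j - c k) ^+ 2 + (s j - s k) ^+ 2).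

Lemma chord_shift j m : chord j (m + j) = rho R N m.
Proof.
rewrite /chord /rho /c /s angleD cosD sinD; congr Num.sqrt.
have := cos2Dsin2 (angle R N j) => H.
transitivity ((cos (angle R N j) ^+ 2 + sin (angle R N j) ^+ 2) *
  ((cos (angle R N m) - 1) ^+ 2 + sin (angle R N m) ^+ 2)); first by ring.
by rewrite H mul1r.
Qed.

Lemma chord_periodic j k : chord j (k + N) = chord j k.
Proof.
by rewrite /chord /c /s cos_angle_periodic sin_angle_periodic.
Qed.

(** Indexing the bodies by m = k - j factors the vertex j out of the pull on it:
    what remains is the sum of (1 - zeta ^ m) / rho_m ^ 3, of real part w ^ 2
    and, by [sum_sin_rho], of vanishing imaginary part. *)
Lemma polygon_pull_cos j :
  \sum_(k < N) (c j - c k) * (chord j k)^-1 ^+ 3 = w ^+ 2 * c j.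
Proof.
pose F k := (c j - c k) * (chord j k)^-1 ^+ 3.
rewrite -(periodic_sum_shift (f := F) j); last first.
  by move=> k; rewrite /F chord_periodic /c cos_angle_periodic.
have -> : w ^+ 2 * c j =
    w ^+ 2 * c j + s j * \sum_(m < N) s m * (rho R N m)^-1 ^+ 3.
  by rewrite sum_sin_rho mulr0 addr0.
rewrite omega1_sqr.
rewrite mulr_suml mulr_sumr -big_split /=; apply: eq_bigr => m _.
by rewrite /F chord_shift /c /s angleD cosD; ring.
Qed.

Lemma polygon_pull_sin j :
  \sum_(k < N) (s j - s k) * (chord j k)^-1 ^+ 3 = w ^+ 2 * s j.
Proof.
pose F k := (s j - s k) * (chord j k)^-1 ^+ 3.
rewrite -(periodic_sum_shift (f := F) j); last first.
  by move=> k; rewrite /F chord_periodic /s sin_angle_periodic.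
have -> : w ^+ 2 * s j =
    w ^+ 2 * s j + - c j * \sum_(m < N) s m * (rho R N m)^-1 ^+ 3.
  by rewrite sum_sin_rho mulr0 addr0.
rewrite omega1_sqr.
rewrite mulr_suml mulr_sumr -big_split /=; apply: eq_bigr => m _.
by rewrite /F chord_shift /c /s angleD sinD; ring.
Qed.

Definition sqdist (X : config R N) (j k : 'I_N) : R :=
  \sum_a (X j a - X k a) ^+ 2.

Lemma enorm_rowB (X : config R N) (j k : 'I_N) :
  enorm (row j X - row k X) = Num.sqrt (sqdist X j k).
Proof.
by rewrite /enorm /sqdist; congr Num.sqrt; apply: eq_bigr => a _; rewrite !mxE.
Qed.

Definition invdist (j k : 'I_N) : R := (Num.sqrt (sqdist C j k))^-1.

Lemma sqdist_polygon (j k : 'I_N) :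
  sqdist C j k = (c j - c k) ^+ 2 + (s j - s k) ^+ 2.
Proof.
by rewrite /sqdist !big_ord_recl big_ord0 !mxE /= subrr expr0n !addr0.
Qed.

Lemma invdistE (j k : 'I_N) : invdist j k = (chord j k)^-1.
Proof. by rewrite /invdist sqdist_polygon. Qed.

Lemma sqdist_polygon_gt0 (j k : 'I_N) : j != k -> 0 < sqdist C j k.
Proof.
wlog jk : j k / (j < k)%N => [H|] jNk.
  have [jk|kj|/val_inj jk] := ltngtP j k; [exact: H| |by rewrite jk eqxx in jNk].
  rewrite /sqdist; under eq_bigr do rewrite -sqrrN opprB.
  by apply: H => //; rewrite eq_sym.
rewrite sqdist_polygon -sqrtr_gt0 -/(chord j k) -[val k](subnK (ltnW jk)).
rewrite chord_shift rho_gt0// subn_gt0 jk /=.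
by rewrite (leq_ltn_trans (leq_subr _ _) (ltn_ord k)).
Qed.

Lemma invdist_gt0 (j k : 'I_N) : j != k -> 0 < invdist j k.
Proof. by move=> jk; rewrite invr_gt0 sqrtr_gt0 sqdist_polygon_gt0. Qed.

Lemma invdist_sym (j k : 'I_N) : invdist j k = invdist k j.
Proof.
congr (Num.sqrt _)^-1; rewrite /sqdist; apply: eq_bigr => a _; ring.
Qed.

Lemma sqdist_invdist (j k : 'I_N) : j != k -> sqdist C j k * invdist j k ^+ 2 = 1.
Proof.
move=> jk; have d0 := sqdist_polygon_gt0 jk.
by rewrite exprVn sqr_sqrtr ?ltW// mulfV// gt_eqF.
Qed.

(** Gravity at a vertex balances the centrifugal force of the rotation. *)
Lemma polygon_central (j : 'I_N) (a : 'I_3) :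
  \sum_k (C j a - C k a) * invdist j k ^+ 3 = w ^+ 2 * C j a.
Proof.
under eq_bigr do rewrite invdistE.
case: a => -[|[|[|//]]] ai.
- by rewrite !mxE -polygon_pull_cos; apply: eq_bigr => k _; rewrite !mxE.
- by rewrite !mxE -polygon_pull_sin; apply: eq_bigr => k _; rewrite !mxE.
- by rewrite !mxE mulr0 big1// => k _; rewrite !mxE subrr mul0r.
Qed.

Lemma polygon_centered (a : 'I_3) : \sum_j C j a = 0.
Proof.
have w0 : w ^+ 2 != 0 by rewrite sqrf_eq0 gt_eqF// omega1_gt0.
apply: (mulfI w0); rewrite mulr0 mulr_sumr.
under eq_bigr do rewrite -polygon_central.
rewrite (sum_pairs (fun j k => (C j a - C k a) * invdist j k ^+ 3)).
rewrite [X in _ + X]big1 ?addr0; last by move=> j _; rewrite subrr mul0r.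
by apply: big1 => j _; apply: big1 => k _; rewrite (invdist_sym k j); ring.
Qed.

End Polygon.

(** * The quadratic part of the reduced energy *)

Lemma sum3E (V : nmodType) (F : 'I_3 -> V) : \sum_a F a = F 0 + F 1 + F 2.
Proof.
rewrite !big_ord_recl big_ord0 addr0 addrA.
by congr (F _ + F _ + F _); exact: val_inj.
Qed.

Lemma ord3P (P : 'I_3 -> Prop) : P 0 -> P 1 -> P 2 -> forall a, P a.
Proof.
move=> P0 P1 P2 [[|[|[|//]]] ai].
- by rewrite (_ : Ordinal _ = 0)//; exact: val_inj.
- by rewrite (_ : Ordinal _ = 1)//; exact: val_inj.
- by rewrite (_ : Ordinal _ = 2)//; exact: val_inj.
Qed.

Lemma wedgeE (R : realType) (N : nat) (X Y : config R N) (a b : 'I_3) :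
  wedge X Y a b = \sum_j (X j a * Y j b - X j b * Y j a).
Proof.
rewrite !mxE -sumrB; apply: eq_bigr => j _; rewrite !mxE.
by rewrite [Y j a * _]mulrC.
Qed.

Lemma mulJE (R : realType) (N : nat) (X : config R N) (j : 'I_N) :
  (mulJ X j 0 = - X j 1) * (mulJ X j 1 = X j 0) * (mulJ X j 2 = 0).
Proof. by rewrite !mxE. Qed.

Lemma polygonE (R : realType) (N : nat) (j : 'I_N) :
  (polygon R N j 0 = cos (angle R N j)) * (polygon R N j 1 = sin (angle R N j))
  * (polygon R N j 2 = 0).
Proof. by rewrite !mxE. Qed.

Section Hessian.
Context {R : realType} {N : nat}.
Hypothesis N3 : (3 <= N)%N.
Implicit Types (X P : config R N) (v : state R N).

Let C := polygon R N.
Let w := omega R N 1.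

Definition stretch X (j k : 'I_N) : R :=
  \sum_a (C j a - C k a) * (X j a - X k a).

Definition hess v : R :=
  \sum_j \sum_a v.2 j a ^+ 2
  - 2 * w * \sum_j (v.1 j 0 * v.2 j 1 - v.1 j 1 * v.2 j 0)
  + \sum_(j < N) \sum_(k < N | (j < k)%N)
      (invdist j k ^+ 3 * sqdist v.1 j k
       - 3 * invdist j k ^+ 5 * stretch v.1 j k ^+ 2).

Lemma releq2E (j : 'I_N) :
  ((releq R N).2 j 0 = - (w * C j 1)) * ((releq R N).2 j 1 = w * C j 0)
  * ((releq R N).2 j 2 = 0).
Proof.
have E a : (releq R N).2 j a = w * mulJ C j a by rewrite mxE.
by rewrite !E !mulJE mulr0 mulrN.
Qed.

Lemma polygon_sqr (j : 'I_N) : C j 0 ^+ 2 + C j 1 ^+ 2 = 1.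
Proof. by rewrite !polygonE cos2Dsin2. Qed.

(** The hypothesis says that [P] is an eigenvector, for the eigenvalue w ^ 2, of the
    Laplacian of the complete graph with weights 1 / r ^ 3. The polygon and its
    quarter turn are such configurations; [P] = [X] = polygon is the
    virial identity. *)
Lemma sum_pairs_pull P X :
    (forall j a, \sum_k (P j a - P k a) * invdist j k ^+ 3 = w ^+ 2 * P j a) ->
  \sum_(j < N) \sum_(k < N | (j < k)%N)
     invdist j k ^+ 3 * (\sum_a (P j a - P k a) * (X j a - X k a)) =
  w ^+ 2 * \sum_j \sum_a P j a * X j a.
Proof.
move=> HP.
transitivity (\sum_a \sum_(j < N) \sum_(k < N | (j < k)%N)
    ((P j a - P k a) * invdist j k ^+ 3) * (X j a - X k a)).
  rewrite exchange_big /=; apply: eq_bigr => j _.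
  rewrite exchange_big /=; apply: eq_bigr => k _.
  by rewrite mulr_sumr; apply: eq_bigr => a _; ring.
rewrite [in RHS]exchange_big mulr_sumr /=; apply: eq_bigr => a _.
rewrite (sum_pairs_antisym (g := fun j k => (P j a - P k a) * invdist j k ^+ 3)
  (fun j => X j a)); last first.
  by move=> j k; rewrite (invdist_sym k j); ring.
by rewrite mulr_sumr; apply: eq_bigr => j _; rewrite HP; ring.
Qed.

Lemma mulJ_central j a :
  \sum_k (mulJ C j a - mulJ C k a) * invdist j k ^+ 3 = w ^+ 2 * mulJ C j a.
Proof.
move: a; apply: ord3P.
- rewrite mulJE mulrN -(polygon_central N3) -sumrN.
  by apply: eq_bigr => k _; rewrite !mulJE; ring.
- rewrite mulJE -(polygon_central N3).
  by apply: eq_bigr => k _; rewrite !mulJE; ring.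
- by rewrite mulJE mulr0 big1// => k _; rewrite !mulJE subrr mul0r.
Qed.

(** The reduced energy is critical at the equilibrium: what the accelerations
    [X2] and [Y2] of a curve contribute to the second derivative of the energy
    is traded, through the constancy of the vertical angular momentum [ham],
    for the term of [hess] that pairs [X1] and [Y1]. *)
Lemma energy_jet2 (g : R -> state R N) (X1 X2 Y1 Y2 : config R N) :
    (forall j a, jet2 (fun s => (g s).1 j a) (C j a) (X1 j a) (X2 j a)) ->
    (forall j a, jet2 (fun s => (g s).2 j a)
      ((releq R N).2 j a) (Y1 j a) (Y2 j a)) ->
    (\forall s \near (0 : R), ang_mom (g s) = ang_mom (releq R N)) ->
  exists a b, jet2 (fun s => energy (g s)) a b (hess (X1, Y1)).
Proof.
move=> jX jY ham; set Y := (releq R N).2.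
pose d1 j k := \sum_a 2 * (C j a - C k a) * (X1 j a - X1 k a).
pose d2 j k := \sum_a 2 * ((X1 j a - X1 k a) ^+ 2
                           + (C j a - C k a) * (X2 j a - X2 k a)).
have jd j k : jet2 (fun s => sqdist (g s).1 j k) (sqdist C j k) (d1 j k) (d2 j k).
  by apply: jet2_sum => a _; apply: jet2X2; exact: jet2B.
have jK : jet2 (fun s => 2^-1 * \sum_j \sum_a (g s).2 j a ^+ 2)
   (2^-1 * \sum_j \sum_a Y j a ^+ 2)
   (2^-1 * \sum_j \sum_a 2 * Y j a * Y1 j a)
   (2^-1 * \sum_j \sum_a 2 * (Y1 j a ^+ 2 + Y j a * Y2 j a)).
  by apply: jet2Z; apply: jet2_sum => j _; apply: jet2_sum => a _; exact: jet2X2.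
have jU := jet2_sum (index_enum 'I_N) (P := xpredT)
  (fun j _ => jet2_sum (index_enum 'I_N) (P := fun k : 'I_N => (j < k)%N)
    (fun k jk => jet2_inv_sqrt
       (sqdist_polygon_gt0 N3 (negbT (ltn_eqF jk) : j != k)) (jd j k))).
have jE := jet2B jK jU; do 2 eexists.
have eqE : \forall s \near (0 : R), 2^-1 * (\sum_j \sum_a (g s).2 j a ^+ 2)
    - \sum_(j < N) \sum_(k < N | (j < k)%N) (Num.sqrt (sqdist (g s).1 j k))^-1
    = energy (g s).
  apply: filterE => s; rewrite /energy.
  congr (_ * _ - _).
    apply: eq_bigr => j _; rewrite /enorm sqr_sqrtr; last first.
      by apply: sumr_ge0 => a _; exact: sqr_ge0.
    by apply: eq_bigr => a _; rewrite mxE.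
  by apply: eq_bigr => j _; apply: eq_bigr => k _; rewrite enorm_rowB.
apply: (jet2_eq (jet2_near_eq eqE jE)) => //.
(* the second derivative at 0 of the vertical angular momentum *)
have am0 : \sum_j ((C j 0 * Y2 j 1 + 2 * X1 j 0 * Y1 j 1 + X2 j 0 * Y j 1)
                 - (C j 1 * Y2 j 0 + 2 * X1 j 1 * Y1 j 0 + X2 j 1 * Y j 0)) = 0.
  have jA := jet2_sum (index_enum 'I_N) (P := xpredT)
    (fun j _ => jet2B (jet2M (jX j 0) (jY j 1)) (jet2M (jX j 1) (jY j 0))).
  apply: (jet2_uniq2 jA); apply: jet2_near_eq (jet2_cst (ang_mom (releq R N) 0 1)).
  by apply: filterS ham => s <-; rewrite /ang_mom wedgeE.
have pull := sum_pairs_pull X2 (polygon_central N3).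
rewrite /hess /=.
have -> : 2^-1 * \sum_j \sum_a 2 * (Y1 j a ^+ 2 + Y j a * Y2 j a) =
    \sum_j \sum_a Y1 j a ^+ 2 + w * \sum_j (C j 0 * Y2 j 1 - C j 1 * Y2 j 0).
  rewrite !mulr_sumr -big_split /=; apply: eq_bigr => j _.
  by rewrite !sum3E !releq2E; field.
have -> : \sum_(j < N) \sum_(k < N | (j < k)%N)
     (3 / 4 * (Num.sqrt (sqdist C j k))^-1 ^+ 5 * d1 j k ^+ 2 -
      2^-1 * (Num.sqrt (sqdist C j k))^-1 ^+ 3 * d2 j k) =
   - \sum_(j < N) \sum_(k < N | (j < k)%N)
      (invdist j k ^+ 3 * sqdist X1 j k
       - 3 * invdist j k ^+ 5 * stretch X1 j k ^+ 2)
   - \sum_(j < N) \sum_(k < N | (j < k)%N)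
     invdist j k ^+ 3 * (\sum_a (C j a - C k a) * (X2 j a - X2 k a)).
  rewrite -!sumrN -big_split /=; apply: eq_bigr => j _.
  rewrite -!sumrN -big_split /=; apply: eq_bigr => k _.
  by rewrite -/(invdist j k) /d1 /d2 /stretch /sqdist !sum3E; field.
rewrite pull.
have -> : \sum_j \sum_a C j a * X2 j a = \sum_j (C j 0 * X2 j 0 + C j 1 * X2 j 1).
  by apply: eq_bigr => j _; rewrite sum3E !polygonE mul0r addr0.
have : w * \sum_j (C j 0 * Y2 j 1 - C j 1 * Y2 j 0)
    + w ^+ 2 * (\sum_j (C j 0 * X2 j 0 + C j 1 * X2 j 1))
    + 2 * w * \sum_j (X1 j 0 * Y1 j 1 - X1 j 1 * Y1 j 0) = 0.
  apply: (etrans _ (etrans (congr1 ( *%R w) am0) (mulr0 w))).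
  rewrite !mulr_sumr -!big_split /=; apply: eq_bigr => j _.
  by rewrite !releq2E; ring.
by move=> /eqP; rewrite addr_eq0 => /eqP E; rewrite opprB opprK; lra.
Qed.

(** The form is the Hessian of the augmented energy, which is invariant under
    rotations and critical at the equilibrium: the tangent line to the
    orbit of the rotations lies in its kernel. *)
Lemma hess_rot c v :
  hess (v + c *: (mulJ (releq R N).1, mulJ (releq R N).2)) = hess v.
Proof.
have pX := sum_pairs_pull v.1 mulJ_central.
have pJ := sum_pairs_pull (mulJ C) mulJ_central.
have posE j a : (v.1 + c *: mulJ C) j a = v.1 j a + c * mulJ C j a.
  by rewrite !mxE.
have velE j : ((v.2 + c *: mulJ (w *: mulJ C)) j 0 = v.2 j 0 - c * w * C j 0)
    * ((v.2 + c *: mulJ (w *: mulJ C)) j 1 = v.2 j 1 - c * w * C j 1)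
    * ((v.2 + c *: mulJ (w *: mulJ C)) j 2 = v.2 j 2).
  have E a : (v.2 + c *: mulJ (w *: mulJ C)) j a
      = v.2 j a + c * mulJ (w *: mulJ C) j a by rewrite !mxE.
  by rewrite !E !mulJE ![(w *: mulJ C) j _]mxE !mulJE; split; [split|]; ring.
rewrite /hess /=.
have -> : \sum_j \sum_a (v.2 + c *: mulJ (w *: mulJ C)) j a ^+ 2 =
    \sum_j \sum_a v.2 j a ^+ 2
    - 2 * c * w * \sum_j (C j 0 * v.2 j 0 + C j 1 * v.2 j 1)
    + c ^+ 2 * w ^+ 2 * \sum_j \sum_a mulJ C j a * mulJ C j a.
  rewrite -mulNr !mulr_sumr -!big_split /=; apply: eq_bigr => j _.
  by rewrite !sum3E !velE !mulJE; ring.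
have -> : \sum_j ((v.1 + c *: mulJ C) j 0 * (v.2 + c *: mulJ (w *: mulJ C)) j 1
      - (v.1 + c *: mulJ C) j 1 * (v.2 + c *: mulJ (w *: mulJ C)) j 0) =
    \sum_j (v.1 j 0 * v.2 j 1 - v.1 j 1 * v.2 j 0)
    - c * \sum_j (C j 0 * v.2 j 0 + C j 1 * v.2 j 1)
    + c * w * \sum_j \sum_a v.1 j a * mulJ C j a
    + c ^+ 2 * w * \sum_j \sum_a mulJ C j a * mulJ C j a.
  rewrite -mulNr !mulr_sumr -!big_split /=; apply: eq_bigr => j _.
  by rewrite !sum3E !posE !velE !mulJE; ring.
have -> : \sum_(j < N) \sum_(k < N | (j < k)%N)
     (invdist j k ^+ 3 * sqdist (v.1 + c *: mulJ C) j k
      - 3 * invdist j k ^+ 5 * stretch (v.1 + c *: mulJ C) j k ^+ 2) =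
   \sum_(j < N) \sum_(k < N | (j < k)%N)
     (invdist j k ^+ 3 * sqdist v.1 j k
      - 3 * invdist j k ^+ 5 * stretch v.1 j k ^+ 2)
   + 2 * c * (w ^+ 2 * \sum_j \sum_a mulJ C j a * v.1 j a)
   + c ^+ 2 * (w ^+ 2 * \sum_j \sum_a mulJ C j a * mulJ C j a).
  rewrite -pX -pJ !mulr_sumr -!big_split /=; apply: eq_bigr => j _.
  rewrite !mulr_sumr -!big_split /=; apply: eq_bigr => k _.
  by rewrite /stretch /sqdist !sum3E !posE !mulJE !polygonE; ring.
have -> : \sum_j \sum_a v.1 j a * mulJ C j a = \sum_j \sum_a mulJ C j a * v.1 j a.
  by apply: eq_bigr => j _; apply: eq_bigr => a _; rewrite mulrC.
ring.
Qed.

Lemma reduced_curve_energy v g : reduced_curve v g ->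
  twice_derivable (fun s => energy (g s)) /\
  ((fun s => energy (g s))^`(2))%classic 0 = hess v.
Proof.
move=> [gX gY glevel g0 [c gv]].
have jX j a : jet2 (fun s => (g s).1 j a) (C j a) ((velocity0 g).1 j a)
    ((fun s => (g s).1 j a)^`(2) 0)%classic.
  apply: (jet2_eq (twice_derivable_jet2 (gX j a))) => //; last by rewrite mxE.
  by rewrite g0.
have jY j a : jet2 (fun s => (g s).2 j a) ((releq R N).2 j a)
    ((velocity0 g).2 j a) ((fun s => (g s).2 j a)^`(2) 0)%classic.
  apply: (jet2_eq (twice_derivable_jet2 (gY j a))) => //; last by rewrite mxE.
  by rewrite g0.
pose X2 : config R N := \matrix_(j, a) ((fun s => (g s).1 j a)^`(2) 0)%classic.
pose Y2 : config R N := \matrix_(j, a) ((fun s => (g s).2 j a)^`(2) 0)%classic.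
have X2E j a : X2 j a = ((fun s => (g s).1 j a)^`(2) 0)%classic by rewrite mxE.
have Y2E j a : Y2 j a = ((fun s => (g s).2 j a)^`(2) 0)%classic by rewrite mxE.
have [|||a [b]] := @energy_jet2 g (velocity0 g).1 X2 (velocity0 g).2 Y2.
- by move=> j a; rewrite X2E.
- by move=> j a; rewrite Y2E.
- by apply: filterS glevel => s [_ ->].
rewrite -surjective_pairing -(subrK v (velocity0 g)) gv addrC hess_rot => jE.
by split; [exact: jet2_twice_derivable jE|exact: jet2_derive1n2 jE].
Qed.

End Hessian.

(** * Curves on the momentum level *)

Definition jet1 (R : realType) (f : R -> R) (a b : R) : Prop :=
  exists c, jet2 f a b c.

Section Jet1.
Context {R : realType}.
Implicit Types (f g : R -> R) (a b : R).

Lemma jet1_eq f a b a' b' : jet1 f a b -> a = a' -> b = b' -> jet1 f a' b'.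
Proof. by move=> ? <- <-. Qed.

Lemma jet1_cst a : @jet1 R (fun=> a) a 0.
Proof. by exists 0; exact: jet2_cst. Qed.

Lemma jet1_affine a b : @jet1 R (fun s => a + s * b) a b.
Proof.
exists 0; apply: (jet2_eq (jet2D (jet2_cst a) (jet2M jet2_id (jet2_cst b))));
  by ring.
Qed.

Lemma jet1_quadratic a b : @jet1 R (fun s => a + s * s * b) a 0.
Proof.
exists (2 * b); apply: (jet2_eq (jet2D (jet2_cst a)
  (jet2M (jet2M jet2_id jet2_id) (jet2_cst b)))); by ring.
Qed.

Lemma jet1D f g a b a' b' : jet1 f a b -> jet1 g a' b' ->
  jet1 (fun s => f s + g s) (a + a') (b + b').
Proof. by move=> [c jf] [c' jg]; eexists; exact: jet2D jf jg. Qed.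

Lemma jet1B f g a b a' b' : jet1 f a b -> jet1 g a' b' ->
  jet1 (fun s => f s - g s) (a - a') (b - b').
Proof. by move=> [c jf] [c' jg]; eexists; exact: jet2B jf jg. Qed.

Lemma jet1M f g a b a' b' : jet1 f a b -> jet1 g a' b' ->
  jet1 (fun s => f s * g s) (a * a') (a * b' + b * a').
Proof. by move=> [c jf] [c' jg]; eexists; exact: jet2M jf jg. Qed.

Lemma jet1V f a b : a != 0 -> jet1 f a b ->
  jet1 (fun s => (f s)^-1) a^-1 (- a^-1 ^+ 2 * b).
Proof. by move=> a0 [c jf]; eexists; exact: jet2V jf. Qed.

Lemma jet1_ext f g a b : f =1 g -> jet1 f a b -> jet1 g a b.
Proof.
by move=> fg [c jf]; exists c; apply: jet2_near_eq jf; exact: filterE.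
Qed.

Lemma jet1_at0 f a b : jet1 f a b -> f 0 = a.
Proof. by move=> [c [f' []]]. Qed.

Lemma jet1_continuous f a b : jet1 f a b -> f s @[s --> (0 : R)] --> a.
Proof. by move=> [c jf]; have := jet2_continuous jf; case: jf => f' [_ _ <-]. Qed.

End Jet1.

Section MomentumLevel.
Context {R : realType} {N : nat}.

Lemma wedge_mul (X Y : config R N) (M : 'M[R]_3) :
  wedge (X *m M) (Y *m M) = M^T *m wedge X Y *m M.
Proof. by rewrite /wedge mulmxBr mulmxBl !trmx_mul !mulmxA. Qed.

Lemma wedge_tr (X Y : config R N) : (wedge X Y)^T = - wedge X Y.
Proof. by rewrite /wedge linearB /= !trmx_mul !trmxK opprB. Qed.

Lemma wedge_affine (X X' Y Y' : config R N) (s : R) :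
  wedge (X + s *: X') (Y + s *: Y') =
  wedge X Y + s *: (wedge X' Y + wedge X Y') + (s * s) *: wedge X' Y'.
Proof.
rewrite /wedge !linearD /= !linearZ /= !mulmxDl -?scalemxAl -?scalemxAr.
by apply/matrixP => a b; rewrite !mxE; ring.
Qed.

(** The columns form a symplectic basis for the bivector [W], made by scaling the
    first basis vector and shearing the third one along the first two: congruence
    by this matrix turns [W] into the vertical bivector of size [L]. The matrix
    is the identity if [W] already is that bivector, and depends smoothly on [W],
    which makes it a correction of second order in [lifted_curve]. *)
Definition normalizer (L : R) (W : 'M[R]_3) : 'M[R]_3 :=
  \matrix_(i, k) (nth [::] [:: [:: L / W 0 1; 0; W 1 2 / W 0 1];
                              [:: 0; 1; - (W 0 2 / W 0 1)]; [:: 0; 0; 1]] i)`_k.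

Definition vertical_bivector (L : R) : 'M[R]_3 :=
  L *: (delta_mx 0 1 - delta_mx 1 0).

Lemma normalizerP (L : R) (W : 'M[R]_3) : W^T = - W -> W 0 1 != 0 ->
  (normalizer L W)^T *m W *m normalizer L W = vertical_bivector L.
Proof.
move=> WT W01.
have WN i k : W i k = - W k i.
  by have := congr1 (fun M : 'M[R]_3 => M k i) WT; rewrite !mxE.
have W0 i : W i i = 0 by apply/eqP; rewrite -eqNr -WN.
apply/matrixP; apply: ord3P; apply: ord3P;
  rewrite !mxE !sum3E !mxE !sum3E !mxE /= !W0 ?(WN 1 0) ?(WN 2 0) ?(WN 2 1);
  by field.
Qed.

End MomentumLevel.

Section Curves.
Context {R : realType} {N : nat}.
Hypothesis N3 : (3 <= N)%N.
Implicit Types v : state R N.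

Let C := polygon R N.
Let w := omega R N 1.
Let L := w * N%:R.

Let L0 : L != 0.
Proof.
by rewrite mulf_neq0// ?gt_eqF ?omega1_gt0// ltr0n (ltn_trans _ N3).
Qed.

Lemma ang_mom_releq : ang_mom (releq R N) = vertical_bivector L.
Proof.
have E a b : ang_mom (releq R N) a b = \sum_j
  (C j a * (releq R N).2 j b - C j b * (releq R N).2 j a) by rewrite wedgeE.
have E01 : \sum_j (C j 0 * (releq R N).2 j 1 - C j 1 * (releq R N).2 j 0) = L.
  rewrite /L mulr_natr -[X in _ *+ X](card_ord N) -sumr_const.
  apply: eq_bigr => j _; rewrite !releq2E -/w -[RHS]mulr1 -(polygon_sqr j).
  by rewrite -/C; ring.
have E2 a : \sum_j (C j a * (releq R N).2 j 2 - C j 2 * (releq R N).2 j a) = 0.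
  by apply: big1 => j _; rewrite !releq2E !polygonE; ring.
have EN a b : \sum_j (C j a * (releq R N).2 j b - C j b * (releq R N).2 j a) =
    - \sum_j (C j b * (releq R N).2 j a - C j a * (releq R N).2 j b).
  by rewrite -sumrN; apply: eq_bigr => j _; rewrite opprB.
have Eaa a : \sum_j (C j a * (releq R N).2 j a - C j a * (releq R N).2 j a) = 0.
  by apply: big1 => j _; rewrite subrr.
apply/matrixP; apply: ord3P; apply: ord3P; rewrite E !mxE /=
  ?Eaa ?E2 ?E01 1?EN ?E01 ?E2; by ring.
Qed.

Let straight v (s : R) : state R N := releq R N + s *: v.

Lemma straight_ang_mom v s : tangent v ->
  ang_mom (straight v s) = ang_mom (releq R N) + (s * s) *: wedge v.1 v.2.
Proof.
move=> [_ dv]; rewrite /ang_mom /= wedge_affine.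
by rewrite -/(ang_mom_var v) dv scaler0 addr0.
Qed.

Lemma straight_centered v s : tangent v -> centered (straight v s).
Proof.
move=> [[vX vY] _]; have rowsum (X X' : config R N) :
    (forall a, \sum_j X j a = 0) -> \sum_j row j X' = 0 ->
    \sum_j row j (X + s *: X') = 0.
  move=> X0 X'0; under eq_bigr do rewrite linearD linearZ /=.
  rewrite big_split /= -scaler_sumr X'0 scaler0 addr0.
  apply/rowP => a; rewrite summxE mxE -[RHS](X0 a).
  by apply: eq_bigr => j _; rewrite mxE.
split; apply: rowsum => // a; first exact: polygon_centered.
move: a; apply: ord3P.
- under eq_bigr do rewrite releq2E -mulrN.
  by rewrite -mulr_sumr sumrN polygon_centered// oppr0 mulr0.
- under eq_bigr do rewrite releq2E.
  by rewrite -mulr_sumr polygon_centered// mulr0.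
- by apply: big1 => j _; rewrite releq2E.
Qed.

(** The straight line through the equilibrium with a tangent velocity leaves the
    momentum level at the second order only. A linear change of coordinates
    of space that differs from the identity at that order, and that acts alike on
    positions and velocities, brings the angular momentum back to its value. *)
Definition lifted_curve v (s : R) : state R N :=
  let M := normalizer L (ang_mom (straight v s)) in
  ((straight v s).1 *m M, (straight v s).2 *m M).

Lemma lifted_curve_jet1 v : tangent v ->
  (forall j a, jet1 (fun s => (lifted_curve v s).1 j a) (C j a) (v.1 j a)) /\
  (forall j a, jet1 (fun s => (lifted_curve v s).2 j a)
     ((releq R N).2 j a) (v.2 j a)).
Proof.
move=> tv; pose W s := ang_mom (straight v s).
have W2 (i k : 'I_3) : jet1 (fun s => W s i k) (vertical_bivector L i k) 0.
  apply: jet1_ext (jet1_quadratic _ (wedge v.1 v.2 i k)) => s.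
  rewrite /W straight_ang_mom// ang_mom_releq [RHS]mxE; congr (_ + _).
  by rewrite [RHS]mxE.
have V01 : vertical_bivector L 0 1 = L by rewrite !mxE /=; ring.
have V02 : vertical_bivector L 0 2 = 0 by rewrite !mxE /=; ring.
have V12 : vertical_bivector L 1 2 = 0 by rewrite !mxE /=; ring.
have jV : jet1 (fun s => (W s 0 1)^-1) L^-1 0.
  have V0 : vertical_bivector L 0 1 != 0 by rewrite V01.
  by apply: (jet1_eq (jet1V V0 (W2 0 1))); rewrite V01 ?mulr0.
pose n s := normalizer L (W s).
have j00 : jet1 (fun s => L / W s 0 1) 1 0.
  by apply: (jet1_eq (jet1M (jet1_cst L) jV)); [rewrite mulfV|ring].
have j02 : jet1 (fun s => W s 1 2 / W s 0 1) 0 0.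
  by apply: (jet1_eq (jet1M (W2 1 2) jV)); rewrite V12; ring.
have j12 : jet1 (fun s => W s 0 2 / W s 0 1) 0 0.
  by apply: (jet1_eq (jet1M (W2 0 2) jV)); rewrite V02; ring.
have jZ (X X' : config R N) j :
    let Z s := (X + s *: X') *m n s in
    forall a, jet1 (fun s => Z s j a) (X j a) (X' j a).
  have jX a : jet1 (fun s => (X + s *: X') j a) (X j a) (X' j a).
    by apply: jet1_ext (jet1_affine _ _) => s; rewrite !mxE.
  move=> Z; apply: ord3P.
  - apply: (jet1_ext (f := fun s => (X + s *: X') j 0 * (L / W s 0 1))).
      by move=> s; rewrite [RHS]mxE sum3E ![n s _ _]mxE /= !mulr0 !addr0.
    by apply: (jet1_eq (jet1M (jX 0) j00)); ring.
  - apply: (jet1_ext (f := fun s => (X + s *: X') j 1)) => // s.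
    by rewrite [RHS]mxE sum3E ![n s _ _]mxE /= !mulr0 mulr1 addr0 add0r.
  - apply: (jet1_ext (f := fun s => (X + s *: X') j 2
      + ((X + s *: X') j 0 * (W s 1 2 / W s 0 1)
         - (X + s *: X') j 1 * (W s 0 2 / W s 0 1)))).
      by move=> s; rewrite [RHS]mxE sum3E ![n s _ _]mxE /=; ring.
    by apply: (jet1_eq (jet1D (jX 2) (jet1B (jet1M (jX 0) j02)
      (jet1M (jX 1) j12)))); ring.
by split=> j a; exact: jZ.
Qed.

Lemma lifted_curve_reduced v : tangent v -> reduced_curve v (lifted_curve v).
Proof.
move=> tv; have [jX jY] := lifted_curve_jet1 tv.
have twice f (a b : R) : jet1 f a b -> twice_derivable f.
  by move=> [c]; exact: jet2_twice_derivable.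
have deriv f (a b : R) : jet1 f a b -> (f^`() 0)%classic = b.
  by move=> [c]; exact: jet2_derive1.
split; [by move=> j a; exact: twice|by move=> j a; exact: twice| | |].
- have W01 : \forall s \near (0 : R), ang_mom (straight v s) 0 1 != 0.
    have jW : jet1 (fun s => ang_mom (straight v s) 0 1) L 0.
      have -> : L = ang_mom (releq R N) 0 1.
        by rewrite ang_mom_releq !mxE /=; ring.
      apply: jet1_ext (jet1_quadratic _ (wedge v.1 v.2 0 1)) => s.
      by rewrite straight_ang_mom// [RHS]mxE; congr (_ + _); rewrite [RHS]mxE.
    exact: cvgr_neq0 (jet1_continuous jW) L0.
  have apart : \forall s \near (0 : R), forall jk : 'I_N * 'I_N,
      jk.1 != jk.2 -> 0 < sqdist (lifted_curve v s).1 jk.1 jk.2.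
    suff H (jk : 'I_N * 'I_N) : \forall s \near (0 : R), jk.1 != jk.2 ->
        0 < sqdist (lifted_curve v s).1 jk.1 jk.2 by exact: filter_forall H.
    case: jk => j k /=; case: (eqVneq j k) => [_|jk].
      by apply: filterE.
    have [b jd] : exists b,
        jet1 (fun s => sqdist (lifted_curve v s).1 j k) (sqdist C j k) b.
      have jx a := jet1B (jX j a) (jX k a).
      eexists; rewrite [sqdist C j k]/sqdist sum3E !expr2.
      apply: jet1_ext (jet1D (jet1D (jet1M (jx 0) (jx 0)) (jet1M (jx 1) (jx 1)))
        (jet1M (jx 2) (jx 2))) => s.
      by rewrite /sqdist sum3E !expr2.
    by apply: filterS (cvgr_gt _ (jet1_continuous jd) _
      (sqdist_polygon_gt0 N3 jk)) => s sd _.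
  apply: filterS2 W01 apart => s s0 sapart; split; last first.
    by rewrite ang_mom_releq /ang_mom /= wedge_mul normalizerP ?wedge_tr.
  split.
    have [cX cY] := straight_centered s tv.
    by split; under eq_bigr do rewrite row_mul; rewrite -mulmx_suml ?cX ?cY mul0mx.
  move=> j k jk Ejk; have /= := sapart (j, k) jk.
  rewrite /sqdist big1 ?ltxx// => a _.
  have := congr1 (fun r : 'rV[R]_3 => r 0 a) Ejk; rewrite ![row _ _ _ _]mxE => ->.
  by rewrite subrr expr0n.
- apply/pair_equal_spec; split; apply/matrixP => j a.
    exact: (jet1_at0 (jX j a)).
  exact: (jet1_at0 (jY j a)).
- exists 0; rewrite scale0r; apply/eqP; rewrite subr_eq0; apply/eqP.
  rewrite [RHS]surjective_pairing; apply/pair_equal_spec.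
  by split; apply/matrixP => j a; rewrite mxE; apply: deriv.
Qed.

Theorem hess_is_reduced_hessian : is_reduced_hessian (@hess R N).
Proof.
move=> v tv; split; first by exists (lifted_curve v); exact: lifted_curve_reduced.
by move=> g; exact: reduced_curve_energy.
Qed.

End Curves.

(** * Positivity *)

Section Positivity.
Context {R : realType} {N : nat}.
Hypothesis N3 : (3 <= N)%N.
Implicit Types (v h u : state R N).

Let C := polygon R N.
Let w := omega R N 1.

Let N0 : (N == 0)%N = false.
Proof. by apply/negbTE; rewrite -lt0n (ltn_trans _ N3). Qed.

Definition planar v := forall j, v.1 j 2 = 0 /\ v.2 j 2 = 0.

Definition upright v := forall j,
  [/\ v.1 j 0 = 0, v.1 j 1 = 0, v.2 j 0 = 0 & v.2 j 1 = 0].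

Lemma hess_planar_upright h u : planar h -> upright u ->
  hess (h + u) = hess h + hess u.
Proof.
move=> hh uu; rewrite /hess /=.
have D (X Y : config R N) j a : (X + Y) j a = X j a + Y j a by rewrite mxE.
have -> : \sum_j \sum_a (h.2 + u.2) j a ^+ 2 =
    \sum_j \sum_a h.2 j a ^+ 2 + \sum_j \sum_a u.2 j a ^+ 2.
  rewrite -big_split /=; apply: eq_bigr => j _.
  by rewrite !sum3E !D; have [_ ->] := hh j; have [_ _ -> ->] := uu j; ring.
have -> : \sum_j ((h.1 + u.1) j 0 * (h.2 + u.2) j 1
                  - (h.1 + u.1) j 1 * (h.2 + u.2) j 0) =
    \sum_j (h.1 j 0 * h.2 j 1 - h.1 j 1 * h.2 j 0)
    + \sum_j (u.1 j 0 * u.2 j 1 - u.1 j 1 * u.2 j 0).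
  rewrite -big_split /=; apply: eq_bigr => j _.
  by rewrite !D; have [-> -> -> ->] := uu j; ring.
rewrite [X in _ + X](_ : _ = \sum_(j < N) \sum_(k < N | (j < k)%N)
      (invdist j k ^+ 3 * sqdist h.1 j k
       - 3 * invdist j k ^+ 5 * stretch h.1 j k ^+ 2) +
    \sum_(j < N) \sum_(k < N | (j < k)%N)
      (invdist j k ^+ 3 * sqdist u.1 j k
       - 3 * invdist j k ^+ 5 * stretch u.1 j k ^+ 2)); first by ring.
rewrite -big_split /=; apply: eq_bigr => j _.
rewrite -big_split /=; apply: eq_bigr => k _.
rewrite /sqdist /stretch !sum3E !D !(polygonE R j) !(polygonE R k).
have [-> _] := hh j; have [-> _] := hh k.
by have [-> -> _ _] := uu j; have [-> -> _ _] := uu k; ring.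
Qed.

(** Vertical displacements are orthogonal to the planar polygon: to first order
    they leave the distances fixed, and to second order they increase them.
    Hence the negative terms of the form, due to the radial stretching of the
    pairs, are absent. *)
Lemma hess_upright u : upright u ->
  hess u = \sum_j u.2 j 2 ^+ 2 + \sum_(j < N) \sum_(k < N | (j < k)%N)
    invdist j k ^+ 3 * (u.1 j 2 - u.1 k 2) ^+ 2.
Proof.
move=> uu; rewrite /hess [X in _ - _ * X]big1 ?mulr0 ?subr0; last first.
  by move=> j _; have [-> -> _ _] := uu j; ring.
congr (_ + _); apply: eq_bigr => j _.
  by rewrite sum3E; have [_ _ -> ->] := uu j; ring.
apply: eq_bigr => k _.
rewrite /sqdist /stretch !sum3E !(polygonE R j) !(polygonE R k).
by have [-> -> _ _] := uu j; have [-> -> _ _] := uu k; ring.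
Qed.

Lemma hess_upright_ge0 u : upright u -> 0 <= hess u.
Proof.
move=> /hess_upright->; rewrite addr_ge0 ?sumr_ge0// => j _; first exact: sqr_ge0.
rewrite sumr_ge0// => k jk; rewrite mulr_ge0 ?sqr_ge0// exprn_ge0//.
by rewrite invr_ge0 sqrtr_ge0.
Qed.

Lemma hess_upright_eq0 u : upright u -> \sum_j u.1 j 2 = 0 ->
  hess u = 0 -> u = 0.
Proof.
move=> uu u0; rewrite (hess_upright uu).
have pair_ge0 (j k : 'I_N) : 0 <= invdist j k ^+ 3 * (u.1 j 2 - u.1 k 2) ^+ 2.
  by rewrite mulr_ge0 ?sqr_ge0// exprn_ge0// invr_ge0 sqrtr_ge0.
move=> /eqP; rewrite paddr_eq0 ?sumr_ge0//; last first.
- by move=> j _; rewrite sumr_ge0.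
- by move=> j _; exact: sqr_ge0.
rewrite !psumr_eq0;
  [|by move=> j _; rewrite sumr_ge0|by move=> j _; exact: sqr_ge0].
move=> /andP[/allP v0 /allP z0].
have vE j : u.2 j 2 = 0.
  by apply/eqP; rewrite -sqrf_eq0; apply: v0; rewrite mem_index_enum.
have zlt (j k : 'I_N) : (j < k)%N -> u.1 j 2 = u.1 k 2.
  move=> jk; have /= := z0 j (mem_index_enum _).
  rewrite psumr_eq0// => /allP /(_ k (mem_index_enum _)); rewrite jk /=.
  have jNk : j != k by rewrite -val_eqE /= ltn_eqF.
  rewrite mulf_eq0 expf_eq0 /= gt_eqF ?(invdist_gt0 N3)//=.
  by rewrite sqrf_eq0 subr_eq0 => /eqP.
have zE (j k : 'I_N) : u.1 j 2 = u.1 k 2.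
  by case: (ltngtP j k) => [/zlt|/zlt|/val_inj ->].
have z0E j : u.1 j 2 = 0.
  have : u.1 j 2 *+ N = 0.
    rewrite -[X in _ *+ X](card_ord N) -sumr_const -[RHS]u0.
    by apply: eq_bigr => k _; exact: zE.
  by move/eqP; rewrite mulrn_eq0 N0 => /eqP.
rewrite (surjective_pairing u); apply/pair_equal_spec.
by split; apply/matrixP => j; apply: ord3P; rewrite mxE//;
  have [] := uu j.
Qed.

Lemma cscaleE (a1 a2 : R) (j : 'I_N) :
  (Defs.cscale a1 a2 C j 0 = a1 * C j 0 - a2 * C j 1)
  * (Defs.cscale a1 a2 C j 1 = a1 * C j 1 + a2 * C j 0)
  * (Defs.cscale a1 a2 C j 2 = 0).
Proof.
have E a : Defs.cscale a1 a2 C j a = a1 * C j a + a2 * mulJ C j a by rewrite !mxE.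
by rewrite !E !mulJE !polygonE; split; [split|]; ring.
Qed.

Lemma sum_cst (x : R) : \sum_(j < N) x = N%:R * x.
Proof. by rewrite sumr_const card_ord mulr_natl. Qed.

Lemma homographic_planar h : homographic h -> planar h.
Proof. by move=> [_ [a1 [a2 [b1 [b2 ->]]]]] j /=; rewrite !cscaleE. Qed.

(** Each body contributes w a1 + b2 to the variation of the vertical angular
    momentum. *)
Lemma homographic_momentum (a1 a2 b1 b2 : R) :
  tangent (Defs.cscale a1 a2 C, Defs.cscale b1 b2 C) -> b2 = - (w * a1).
Proof.
move=> [_ /(congr1 (fun M : 'M[R]_3 => M 0 1))].
have DM (A B : 'M[R]_3) : (A + B) 0 1 = A 0 1 + B 0 1 by rewrite mxE.
rewrite /ang_mom_var /= DM !wedgeE [RHS]mxE -big_split /=.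
rewrite (eq_bigr (fun=> w * a1 + b2)); last first.
  move=> j _; rewrite !releq2E !cscaleE -/w -/C -[RHS]mulr1 -(polygon_sqr j) -/C.
  by ring.
rewrite sum_cst => /eqP; rewrite mulf_eq0 pnatr_eq0 N0 /=.
by rewrite addrC addr_eq0 => /eqP.
Qed.

(** All pairs are stretched at the same rate a1, so that the potential terms add
    up to (a2 ^ 2 - 2 a1 ^ 2) times the sum of the 1 / r, which is N w ^ 2; with
    b2 = - w a1 the whole is a sum of two squares. *)
Lemma hess_homographic (a1 a2 b1 b2 : R) :
  tangent (Defs.cscale a1 a2 C, Defs.cscale b1 b2 C) ->
  hess (Defs.cscale a1 a2 C, Defs.cscale b1 b2 C) =
  N%:R * ((b1 + w * a2) ^+ 2 + (w * a1) ^+ 2).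
Proof.
move=> /homographic_momentum b2E; rewrite /hess /=.
have C1 j : C j 0 ^+ 2 + C j 1 ^+ 2 = 1 by exact: polygon_sqr.
rewrite (eq_bigr (fun=> b1 ^+ 2 + b2 ^+ 2)); last first.
  by move=> j _; rewrite sum3E !cscaleE -[RHS]mulr1 -(C1 j); ring.
rewrite [X in _ - _ * X](eq_bigr (fun=> a1 * b2 - a2 * b1)); last first.
  by move=> j _; rewrite !cscaleE -[RHS]mulr1 -(C1 j); ring.
have -> : \sum_(j < N) \sum_(k < N | (j < k)%N)
     (invdist j k ^+ 3 * sqdist (Defs.cscale a1 a2 C) j k
      - 3 * invdist j k ^+ 5 * stretch (Defs.cscale a1 a2 C) j k ^+ 2) =
    (a2 ^+ 2 - 2 * a1 ^+ 2) * (w ^+ 2 * N%:R).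
  have <- : \sum_j \sum_a C j a * C j a = N%:R :> R.
    rewrite -[RHS]mulr1 -sum_cst; apply: eq_bigr => j _.
    by rewrite sum3E !(polygonE R j) -[RHS](C1 j) !(polygonE R j); ring.
  rewrite -(sum_pairs_pull C (polygon_central N3)) mulr_sumr.
  apply: eq_bigr => j _; rewrite mulr_sumr; apply: eq_bigr => k jk.
  have jNk : j != k by rewrite -val_eqE /= ltn_eqF.
  set d := \sum_a (C j a - C k a) * (C j a - C k a).
  have dE : sqdist C j k = d by apply: eq_bigr => a _; rewrite expr2.
  have -> : sqdist (Defs.cscale a1 a2 C) j k = (a1 ^+ 2 + a2 ^+ 2) * d.
    by rewrite /d /sqdist !sum3E !cscaleE !(polygonE R j) !(polygonE R k); ring.
  have -> : stretch (Defs.cscale a1 a2 C) j k = a1 * d.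
    by rewrite /d /stretch !sum3E !cscaleE !(polygonE R j) !(polygonE R k); ring.
  have := sqdist_invdist (R := R) N3 jNk; rewrite -/C dE => di.
  transitivity (invdist j k ^+ 3 * d * (a1 ^+ 2 + a2 ^+ 2
    - 3 * a1 ^+ 2 * (d * invdist j k ^+ 2))); first by ring.
  by rewrite di; ring.
by rewrite !sum_cst b2E -/w; ring.
Qed.

Lemma homographic_ge0 h : homographic h -> 0 <= hess h.
Proof.
move=> [th [a1 [a2 [b1 [b2 hE]]]]]; rewrite hE in th *.
by rewrite hess_homographic// mulr_ge0 ?ler0n// addr_ge0 ?sqr_ge0.
Qed.

Lemma homographic_eq0 h : homographic h -> hess h = 0 -> rot_line h.
Proof.
move=> [th [a1 [a2 [b1 [b2 hE]]]]]; rewrite hE in th *.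
rewrite hess_homographic// => /eqP.
rewrite mulf_eq0 pnatr_eq0 N0 /=.
rewrite paddr_eq0 ?sqr_ge0// !sqrf_eq0 addr_eq0 mulf_eq0 => /andP[/eqP b1E].
rewrite gt_eqF ?omega1_gt0//= => /eqP a10.
have b2E := homographic_momentum th.
exists a2; apply/pair_equal_spec; split => /=.
  by rewrite /Defs.cscale a10 scale0r add0r.
apply/matrixP => j; have E a : (a2 *: mulJ (w *: mulJ C)) j a =
    a2 * mulJ (w *: mulJ C) j a by rewrite mxE.
have F a : (w *: mulJ C) j a = w * mulJ C j a by rewrite mxE.
by apply: ord3P; rewrite cscaleE E mulJE ?F ?mulJE ?b1E ?b2E ?a10; ring.
Qed.

Lemma sum_fstE (r : seq nat) (U : nat -> state R N) j a :
  (\sum_(l <- r) U l).1 j a = \sum_(l <- r) (U l).1 j a.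
Proof. by rewrite (big_morph fst (fun _ _ => erefl) erefl) summxE. Qed.

Lemma sum_sndE (r : seq nat) (U : nat -> state R N) j a :
  (\sum_(l <- r) U l).2 j a = \sum_(l <- r) (U l).2 j a.
Proof. by rewrite (big_morph snd (fun _ _ => erefl) erefl) summxE. Qed.

Lemma csum_cols h (U : nat -> state R N) : components h U ->
  let u := \sum_(1 <= l < N./2.+1) U l in upright u /\ \sum_j u.1 j 2 = 0.
Proof.
move=> [_ HU] u.
have cols l j : (1 <= l < N./2.+1)%N -> [/\ (U l).1 j 0 = 0, (U l).1 j 1 = 0,
    (U l).2 j 0 = 0 & (U l).2 j 1 = 0].
  by move=> /HU[_ [a [b [a' [b' ->]]]]] /=; rewrite !mxE.
split.
  by move=> j; split; rewrite ?sum_fstE ?sum_sndE big_nat big1// => l /(cols l j)[].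
under eq_bigr do rewrite sum_fstE.
rewrite exchange_big big_nat big1// => l /HU[[[+ _] _] _].
move=> /(congr1 (fun r : 'rV[R]_3 => r 0 2)); rewrite summxE mxE => z0.
by rewrite -[RHS]z0; apply: eq_bigr => j _; rewrite mxE.
Qed.

Theorem hess_positive_definite : positive_definite_on (@in_F R N) (@hess R N).
Proof.
move=> v [h [U [hU ->]]] vrot; have [uu uc] := csum_cols hU.
have [hh _] := hU; rewrite /csum.
rewrite hess_planar_upright//; last exact: homographic_planar.
have h0 := homographic_ge0 hh; have u0 := hess_upright_ge0 uu.
rewrite lt_def addr_ge0// andbT paddr_eq0//; apply/negP => /andP[/eqP h0E /eqP u0E].
apply: vrot; rewrite /csum (hess_upright_eq0 uu uc u0E) addr0.
exact: homographic_eq0.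
Qed.

End Positivity.

(** * Independence of the vertical modes *)

(** The operator f(j + 1) + f(j - 1) is symmetric on periodic sequences, so its
    eigenvectors for distinct eigenvalues are orthogonal. The eigenvalue
    equations are shifted by one to avoid the predecessor of 0. *)
Lemma periodic_eigen_orthogonal (R : idomainType) (N : nat) (f g : nat -> R)
    (lam mu : R) :
    (forall j, f (j + N)%N = f j) -> (forall j, g (j + N)%N = g j) ->
    (forall j, f j.+2 + f j = lam * f j.+1) ->
    (forall j, g j.+2 + g j = mu * g j.+1) -> lam != mu ->
  \sum_(j < N) f j * g j = 0.
Proof.
move=> fN gN fl gm lm; apply/eqP.
suff : (lam - mu) * (\sum_(j < N) f j * g j) == 0.
  by rewrite mulf_eq0 subr_eq0 (negbTE lm).
have shift1 (F : nat -> R) : (forall j, F (j + N)%N = F j) ->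
    \sum_(j < N) F j.+1 = \sum_(j < N) F j.
  move=> FN; rewrite -(periodic_sum_shift 1 FN).
  by apply: eq_bigr => j _; rewrite addn1.
have E (h : nat -> R) (nu : R) (k : nat -> R) :
    (forall j, h j.+2 + h j = nu * h j.+1) ->
    (forall j, h (j + N)%N = h j) -> (forall j, k (j + N)%N = k j) ->
    nu * (\sum_(j < N) h j * k j) =
    \sum_(j < N) h j.+1 * k j + \sum_(j < N) h j * k j.+1.
  move=> hnu hN kN.
  rewrite -(shift1 (fun j => h j * k j)); last by move=> j; rewrite hN kN.
  rewrite -(shift1 (fun j => h j.+1 * k j)); last first.
    by move=> j; rewrite -addSn hN kN.
  rewrite mulr_sumr -big_split /=; apply: eq_bigr => j _.
  by rewrite mulrA -hnu mulrDl.
rewrite mulrBl (E f lam g)//.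
under [X in mu * X]eq_bigr do rewrite mulrC.
rewrite (E g mu f)// subr_eq0 [X in _ == X]addrC; apply/eqP.
by congr (_ + _); apply: eq_bigr => j _; rewrite mulrC.
Qed.

Section Modes.
Context {R : realType} {N : nat}.
Hypothesis N3 : (3 <= N)%N.

Let N_gt0 : 0 < N%:R :> R.
Proof. by rewrite ltr0n (ltn_trans _ N3). Qed.

Definition mode (l : nat) (a b : R) (j : nat) : R :=
  a * cos (angle R N (j * l)) + b * sin (angle R N (j * l)).

Lemma mode_periodic l a b j : mode l a b (j + N) = mode l a b j.
Proof.
have H m : cos (angle R N (j * l + N * m)) = cos (angle R N (j * l)) /\
    sin (angle R N (j * l + N * m)) = sin (angle R N (j * l)).
  elim: m => [|m [IHc IHs]]; first by rewrite muln0 addn0.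
  by rewrite mulnS addnCA addnC cos_angle_periodic ?sin_angle_periodic.
by rewrite /mode mulnDl; have [-> ->] := H l.
Qed.

Lemma mode_eigen l a b j :
  mode l a b j.+2 + mode l a b j = 2 * cos (angle R N l) * mode l a b j.+1.
Proof.
have E : angle R N (j * l) = angle R N (j.+1 * l) - angle R N l.
  by rewrite mulSn angleD; ring.
rewrite /mode [(j.+2 * l)%N]mulSn [(l + _)%N]addnC angleD E.
by rewrite !cosD !sinD cosN sinN; ring.
Qed.

Lemma mode_eigenvalue_inj l m : (l <= N./2)%N -> (m <= N./2)%N ->
  cos (angle R N l) = cos (angle R N m) -> l = m.
Proof.
(* the bound N / 2 keeps the arguments in the interval where cos is injective *)
have in0pi k : (k <= N./2)%N -> angle R N k \in `[0, pi]%R.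
  move=> kN; rewrite in_itv /=; apply/andP; split.
    by rewrite /angle divr_ge0 ?mulr_ge0 ?pi_ge0 ?ler0n.
  rewrite /angle ler_pdivrMr// mulrAC mulrC ler_pM2l ?pi_gt0//.
  rewrite -natrM ler_nat mulnC muln2.
  by rewrite -(odd_double_half N) (leq_trans _ (leq_addl _ _))// leq_double.
move=> lN mN /(cos_inj (in0pi l lN) (in0pi m mN)).
have NV0 : (N%:R : R)^-1 != 0 by rewrite invr_eq0 gt_eqF.
have pi20 : 2 * pi != 0 :> R by rewrite mulf_neq0 ?pnatr_eq0// gt_eqF ?pi_gt0.
by move=> /(mulIf NV0) /(mulfI pi20) /eqP; rewrite eqr_nat => /eqP.
Qed.

(** The scalar product of the vanishing sum with its term of index [l] reduces to
    the squared norm of this term. *)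
Lemma modes_independent (z : nat -> nat -> R) :
    (forall l, (1 <= l < N./2.+1)%N -> exists a b, z l = mode l a b) ->
    (forall j, (j < N)%N -> \sum_(1 <= l < N./2.+1) z l j = 0) ->
  forall l j, (1 <= l < N./2.+1)%N -> (j < N)%N -> z l j = 0.
Proof.
move=> zM z0 l j lN jN.
have orth m : (1 <= m < N./2.+1)%N -> m != l ->
    \sum_(j < N) z l j * z m j = 0.
  move=> mN ml; have [a [b ->]] := zM l lN; have [a' [b' ->]] := zM m mN.
  apply: (periodic_eigen_orthogonal (mode_periodic l a b)
    (mode_periodic m a' b') (mode_eigen l a b) (mode_eigen m a' b')).
  apply: contra ml => /eqP /mulfI; rewrite pnatr_eq0 => /(_ isT) E.
  apply/eqP/esym/mode_eigenvalue_inj => //.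
    by case/andP: lN.
  by case/andP: mN.
have : \sum_(j < N) z l j * z l j = 0.
  transitivity (\sum_(j < N) z l j * (\sum_(1 <= m < N./2.+1) z m j)).
    under [RHS]eq_bigr do rewrite mulr_sumr.
    rewrite [RHS]exchange_big /= [RHS](bigD1_seq l) ?mem_index_iota ?iota_uniq//=.
    rewrite [X in _ = _ + X]big1_seq ?addr0// => m /andP[ml].
    by rewrite mem_index_iota => mN; exact: orth.
  by apply: big1 => i _; rewrite z0 ?mulr0.
move=> /eqP; rewrite psumr_eq0; last by move=> i _; rewrite -expr2 sqr_ge0.
move=> /allP /(_ (Ordinal jN) (mem_index_enum _)) /=.
by rewrite mulf_eq0 orbb => /eqP.
Qed.

Theorem direct_sum_F : F_is_direct R N.
Proof.
move=> h U hU [c csumE]; have [uu _] := csum_cols hU.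
have hh := homographic_planar hU.1.
pose u := \sum_(1 <= l < N./2.+1) U l.
have E1 j a : h.1 j a + u.1 j a = c * mulJ (releq R N).1 j a.
  have := congr1 (fun p : state R N => p.1 j a) csumE.
  by rewrite /csum -/u /= [LHS]mxE [RHS]mxE.
have E2 j a : h.2 j a + u.2 j a = c * mulJ (releq R N).2 j a.
  have := congr1 (fun p : state R N => p.2 j a) csumE.
  by rewrite /csum -/u /= [LHS]mxE [RHS]mxE.
have u10 j : u.1 j 2 = 0.
  by have := E1 j 2; rewrite mulJE mulr0; have [-> _] := hh j; rewrite add0r.
have u20 j : u.2 j 2 = 0.
  by have := E2 j 2; rewrite mulJE mulr0; have [_ ->] := hh j; rewrite add0r.
have u0 : u = 0.
  rewrite [LHS]surjective_pairing; apply/pair_equal_spec.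
  by split; apply/matrixP => j; apply: ord3P; rewrite mxE//; have [] := uu j.
split; first by exists c; rewrite -csumE /csum -/u u0 addr0.
have /choice[f Hf] l : exists f : R * R * R * R, (1 <= l <= N./2)%N ->
    U l = (vertical_mode N l f.1.1.1 f.1.1.2, vertical_mode N l f.1.2 f.2).
  case: (boolP (1 <= l <= N./2)%N) => [lN|_]; last by exists 0.
  by have [_ [a [b [a' [b' ->]]]]] := hU.2 l lN; exists (a, b, a', b').
have vm l a b (j : 'I_N) : vertical_mode N l a b j 2 = mode l a b j.
  by rewrite mxE.
move=> l lN; exists 0; rewrite scale0r (Hf l lN).
have z1 := modes_independent (z := fun l => mode l (f l).1.1.1 (f l).1.1.2).
have z2 := modes_independent (z := fun l => mode l (f l).1.2 (f l).2).
apply/pair_equal_spec; split; apply/matrixP => j; apply: ord3P;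
  rewrite ?vm [RHS]mxE; try by rewrite mxE.
  apply: z1 => // [m _|i iN]; first by do 2 eexists.
  rewrite -[RHS](u10 (Ordinal iN)) /u sum_fstE big_nat [RHS]big_nat.
  by apply: eq_bigr => m mN; rewrite (Hf m mN) /= vm.
apply: z2 => // [m _|i iN]; first by do 2 eexists.
rewrite -[RHS](u20 (Ordinal iN)) /u sum_sndE big_nat [RHS]big_nat.
by apply: eq_bigr => m mN; rewrite (Hf m mN) /= vm.
Qed.

End Modes.

Theorem proposition20 (R : realType) (N : nat) (hN : (3 <= N)%N) :
  F_is_direct R N /\
  exists Q : state R N -> R,
    is_reduced_hessian Q /\ positive_definite_on (@in_F R N) Q.
Proof.
split; first exact: direct_sum_F.
exists (@hess R N); split.
- exact: hess_is_reduced_hessian.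
- exact: hess_positive_definite.
Qed.
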